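(* There is a universal constant $C$ such that the following holds. Let $\lambda>0$, $\alpha\in(0,1]$, $B_1,B_2\in\mathrm{Sym}_k$, and $\{A^i_j\}_{i\in[n],j\in\{1,2\}}\subseteq\mathrm{Sym}_k$ with $A^i_1\succeq0$ and $A^i_2\preceq0$ for all $i\in[n]$. Suppose at least an $\alpha$-fraction of the indices $i\in[n]$ satisfy both $A^i_1\succeq\lambda\mathbb I$ and $A^i_2\preceq-\lambda\mathbb I$. Then $$\Pr_{\boldsymbol{x}\sim\mathcal U_n}\Big[\exists j\in\{1,2\}:\ \lambda_{\max}\Big(\sum_i\boldsymbol{x}_iA^i_j-B_j\Big)\in(-2\lambda,0]\Big]\le \frac{C}{\alpha\sqrt n}.$$
   Context: $\mathrm{Sym}_k$: real symmetric $k\times k$ matrices; $\preceq$: Löwner order; $\lambda_{\max}$: largest eigenvalue; $\mathcal U_n$: uniform on $\{-1,1\}^n$. *)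

(* Defs.v *)
From HB Require Import structures.
From mathcomp Require Import all_boot all_order all_algebra.
From mathcomp Require Import boolp classical_sets reals.

Set Implicit Arguments.
Unset Strict Implicit.
Unset Printing Implicit Defensive.

Import Order.TTheory GRing.Theory Num.Theory.

Local Open Scope ring_scope.
Local Open Scope classical_set_scope.

Definition psdmx (R : realType) (k : nat) (A : 'M[R]_k) : Prop :=
  A \is symmetricmx /\ forall v : 'rV[R]_k, 0 <= (v *m A *m v^T) 0 0.

Definition loewner_le (R : realType) (k : nat) (A B : 'M[R]_k) : Prop :=
  psdmx (B - A).

(* For [A] symmetric and [0 < k] the set of eigenvalues is finite and nonempty,
   so the supremum is the largest eigenvalue. For [k = 0] this is the junk
   value [sup set0 = 0]. *)
Definition lambda_max (R : realType) (k : nat) (A : 'M[R]_k) : R :=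
  sup [set a : R | eigenvalue A a].

Definition prob_unif (R : realType) (T : finType) (E : pred T) : R :=
  #|E|%:R / #|T|%:R.

(* [{-1,1}^n] is encoded by [{ffun 'I_n -> bool}], the bit [b] standing for the
   sign [(-1)^b]; the uniform distributions correspond. *)
Definition sgn_coord (R : realType) (n : nat) (x : {ffun 'I_n -> bool})
  (i : 'I_n) : R := (-1) ^+ (x i).

(* Main.v *)
Require Import Defs.
From HB Require Import structures.
From mathcomp Require Import all_boot all_order all_algebra.
From mathcomp Require Import boolp classical_sets reals.
From mathcomp Require Import lra.

Import Order.TTheory GRing.Theory Num.Theory.

Local Open Scope ring_scope.

(** Fix [j] and let [F x] be the largest eigenvalue in question. Changing a good
    coordinate in the favourable direction raises [F] by at least [2 lambda], so
    each good edge at a point of [S = {- 2 lambda < F <= 0}] lies on the boundary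
    of [{F > 0}] or of [{F > - 2 lambda}]. In the good directions both sets are
    monotone, so their boundary edges are counted by the correlation of their
    indicators with the sum [s] of the [m] good signs; as [E|s| <= sqrt m], this
    gives [m * P(S) <= 4 * sqrt m], and a union bound over [j] concludes. *)

(** * Largest eigenvalues and quadratic forms *)

Section Rayleigh.
Variables (R : realType) (k : nat).
Implicit Types (A P Q X Y : 'M[R]_k) (v u : 'rV[R]_k).

Lemma symmetricmx_tr A : A \is symmetricmx -> A^T = A.
Proof. by move/is_hermitianmxP; rewrite expr0 scale1r map_mx_id. Qed.

Lemma tr_symmetricmx A : A^T = A -> A \is symmetricmx.
Proof. by move=> trA; apply/is_hermitianmxP; rewrite expr0 scale1r map_mx_id. Qed.

Lemma dotmxE v : (v *m v^T) 0 0 = \sum_i v 0 i ^+ 2.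
Proof. by rewrite mxE; apply: eq_bigr => i _; rewrite mxE expr2. Qed.

Lemma dotmx_ge0 v : 0 <= (v *m v^T) 0 0.
Proof. by rewrite dotmxE sumr_ge0 // => i _; exact: sqr_ge0. Qed.

Lemma dotmx_gt0 v : v != 0 -> 0 < (v *m v^T) 0 0.
Proof.
move=> v0; rewrite lt_neqAle dotmx_ge0 andbT eq_sym; apply: contraNneq v0.
rewrite dotmxE => /psumr_eq0P h; apply/eqP/rowP => i; rewrite mxE.
by apply/eqP; rewrite -sqrf_eq0 h // => j _; exact: sqr_ge0.
Qed.

(** Each product of two coordinates of [v] is at most [|v|^2] in absolute value. The crude constant
    suffices, since only finiteness is needed. *)
Lemma qform_le_norm P v :
  (v *m P *m v^T) 0 0 <= (\sum_i \sum_j `|P i j|) * (v *m v^T) 0 0.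
Proof.
have coord_le i : v 0 i ^+ 2 <= (v *m v^T) 0 0.
  rewrite dotmxE (bigD1 i) //= lerDl sumr_ge0 // => j _; exact: sqr_ge0.
rewrite mxE; under eq_bigr => j _ do rewrite !mxE mulr_suml.
rewrite exchange_big /= mulr_suml; apply: ler_sum => i _.
rewrite mulr_suml; apply: ler_sum => j _.
apply: le_trans (ler_norm _) _.
rewrite mulrAC normrM mulrC ler_wpM2l // ler_norml.
have := coord_le i; have := coord_le j.
by move=> hj hi; apply/andP; split; nra.
Qed.

(* Expand [0 <= q(v - t vQ)] with [q w = w Q w^T] and [t = 1 / c]. *)
Lemma psd_norm_mul_le Q (c : R) v : Q^T = Q ->
  (forall u, 0 <= (u *m Q *m u^T) 0 0) -> 0 < c ->
  (forall u, (u *m Q *m u^T) 0 0 <= c * (u *m u^T) 0 0) ->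
  ((v *m Q) *m (v *m Q)^T) 0 0 <= c * (v *m Q *m v^T) 0 0.
Proof.
move=> trQ Qge0 c0 Qle; set u := v *m Q.
have uu : u *m Q *m v^T = u *m u^T by rewrite -mulmxA /u trmx_mul trQ.
have := Qge0 (v - c^-1 *: u).
have -> : (v - c^-1 *: u)^T = v^T - c^-1 *: u^T by rewrite linearB /= linearZ.
rewrite mulmxBl mulmxBr !mulmxBl -!scalemxAl -!scalemxAr uu -/u.
rewrite !mxE; have := Qle u; have := dotmx_ge0 u; rewrite !mxE.
set a := \sum_i _; set b := \sum_i _; set d := \sum_i _ => a0 ba h.
have cV0 : 0 < c^-1 by rewrite invr_gt0.
have ccV : c * c^-1 = 1 by rewrite divff // gt_eqF.
have : c^-1 * (c^-1 * b) <= c^-1 * a.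
  by rewrite ler_pM2l // -(ler_pM2l c0) mulrA ccV mul1r.
by move=> h2; rewrite -(ler_pM2l cV0) mulrA [_ * c]mulrC ccV mul1r; lra.
Qed.

(** Write [v] as [(v Q) Q^-1]: then [|v|^2] is at most a constant times [|v Q|^2], which
    [psd_norm_mul_le] bounds by a constant times [v Q v^T]. *)
Lemma psd_unit_coercive Q : Q^T = Q ->
  (forall u, 0 <= (u *m Q *m u^T) 0 0) -> Q \in unitmx ->
  exists2 d : R, 0 < d & forall v, d * (v *m v^T) 0 0 <= (v *m Q *m v^T) 0 0.
Proof.
move=> trQ Qge0 Qu.
(* The summand 1 keeps the bound positive even for a zero matrix, so that it can be inverted. *)
pose nrm P := 1 + \sum_i \sum_j `|P i j| : R.
have nrm_gt0 P : 0 < nrm P.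
  by rewrite ltr_pwDl // !sumr_ge0 // => i _; rewrite sumr_ge0.
have nrm_le P u : (u *m P *m u^T) 0 0 <= nrm P * (u *m u^T) 0 0.
  by rewrite (le_trans (qform_le_norm P u)) // ler_wpM2r ?dotmx_ge0 // lerDr.
pose P := invmx Q *m (invmx Q)^T.
exists (nrm P * nrm Q)^-1; first by rewrite invr_gt0 mulr_gt0.
move=> v; rewrite ler_pdivrMl ?mulr_gt0 // -mulrA.
apply: le_trans (_ : _ <= nrm P * ((v *m Q) *m (v *m Q)^T) 0 0) _.
  apply: le_trans (nrm_le _ _); rewrite /P mulmxA (mulmxK Qu) -mulmxA.
  by rewrite -trmx_mul (mulmxK Qu).
by apply: ler_wpM2l; [exact: ltW | exact: psd_norm_mul_le].
Qed.

(* The optimal constant [M] in [v A v^T <= M |v|^2] is an eigenvalue, since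
   otherwise [M I - A] would be coercive and [M] could be lowered. *)
Lemma rayleigh_eigenvalue A : (0 < k)%N -> A^T = A ->
  exists2 M, eigenvalue A M &
    forall v, (v *m A *m v^T) 0 0 <= M * (v *m v^T) 0 0.
Proof.
move=> k0 trA.
pose E : set R :=
  fun c => forall v, (v *m A *m v^T) 0 0 <= c * (v *m v^T) 0 0.
have E0 : nonempty E by exists (\sum_i \sum_j `|A i j|) => v; exact: qform_le_norm.
have quot_lb v c : v != 0 -> E c -> (v *m A *m v^T) 0 0 / (v *m v^T) 0 0 <= c.
  by move=> v0 Ec; rewrite ler_pdivrMr ?dotmx_gt0.
have [w w0] : exists w : 'rV[R]_k, w != 0.
  exists (const_mx 1); apply/eqP => /rowP/(_ (Ordinal k0)).
  by rewrite !mxE => /eqP; rewrite oner_eq0.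
have lbE : has_lbound E by exists ((w *m A *m w^T) 0 0 / (w *m w^T) 0 0) => c; exact: quot_lb.
have EM : E (inf E).
  move=> v; have [->|v0] := eqVneq v 0; first by rewrite !mul0mx !mxE mulr0.
  by rewrite -ler_pdivrMr ?dotmx_gt0 //; apply: lb_le_inf => // c; exact: quot_lb.
exists (inf E) => //; set M := inf E in EM *.
have qE v : (v *m (M%:M - A) *m v^T) 0 0 = M * (v *m v^T) 0 0 - (v *m A *m v^T) 0 0.
  by rewrite mulmxBr mulmxBl mul_mx_scalar -scalemxAl !mxE.
have [nU|U] := boolP ((M%:M - A) \in unitmx); last first.
  rewrite /eigenvalue /eigenspace kermx_eq0 row_free_unit.
  by rewrite -opprB -scaleN1r unitmxZ // unitrN1.
have [||d d0 dP] := psd_unit_coercive (M%:M - A) _ _ nU.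
- by rewrite linearB /= tr_scalar_mx trA.
- by move=> u; rewrite qE subr_ge0; exact: EM.
have : E (M - d) by move=> v; have := dP v; rewrite qE mulrBl; lra.
by move/(ge_inf lbE); rewrite -/M lerDl oppr_ge0 leNgt d0.
Qed.

Lemma eigenvalue_le A (M a : R) :
  (forall v, (v *m A *m v^T) 0 0 <= M * (v *m v^T) 0 0) -> eigenvalue A a -> a <= M.
Proof.
move=> AM /eigenvalueP[v va v0].
by have := AM v; rewrite va -scalemxAl mxE ler_pM2r ?dotmx_gt0.
Qed.

(** The eigenvalue [M] that bounds the quadratic form also bounds every other eigenvalue, so the
    supremum is attained at [M]. *)
Lemma lambda_maxP A : (0 < k)%N -> A \is symmetricmx ->
  eigenvalue A (lambda_max A) /\
  forall v, (v *m A *m v^T) 0 0 <= lambda_max A * (v *m v^T) 0 0.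
Proof.
move=> k0 /symmetricmx_tr trA; have [M eM AM] := rayleigh_eigenvalue _ k0 trA.
suff -> : lambda_max A = M by [].
apply/eqP; rewrite eq_le; apply/andP; split.
  by apply: ge_sup; [exists M | move=> a; exact: eigenvalue_le].
by apply: ub_le_sup => //; exists M => a; exact: eigenvalue_le.
Qed.

(** Test [Y] on an eigenvector [v] of [X] for the eigenvalue [lambda_max X]: there
    [v Y v^T >= v X v^T + c |v|^2]. *)
Lemma lambda_max_shift X Y (c : R) : (0 < k)%N ->
  X \is symmetricmx -> Y \is symmetricmx -> loewner_le c%:M (Y - X) ->
  lambda_max X + c <= lambda_max Y.
Proof.
move=> k0 sX sY [_ le_cYX].
have [/eigenvalueP[v vX v0] _] := lambda_maxP _ k0 sX.
have [_ /(_ v) leY] := lambda_maxP _ k0 sY.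
rewrite -(ler_pM2r (dotmx_gt0 _ v0)) mulrDl; apply: le_trans leY.
have := le_cYX v; rewrite !mulmxBr !mulmxBl vX mul_mx_scalar -!scalemxAl.
by move: (v *m v^T) (v *m Y *m v^T) => P Q; rewrite !mxE; lra.
Qed.

End Rayleigh.

(** * Counting boundary edges on the cube *)

Section Cube.
Variables (R : realType) (I : finType).
Implicit Types (x : {ffun I -> bool}) (i : I) (e : bool) (G : {set I}).

Definition flip i x : {ffun I -> bool} := [ffun j => x j (+) (j == i)].

Lemma flipK i : involutive (flip i).
Proof. by move=> x; apply/ffunP => j; rewrite !ffunE addbK. Qed.

(* [1] when the coordinate equals the favourable bit [e], [-1] otherwise. *)
Definition bias e x i : R := (-1) ^+ (x i (+) e).

Lemma bias_flip e i x j :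
  bias e (flip i x) j = if j == i then - bias e x j else bias e x j.
Proof.
rewrite /bias ffunE; case: (j == i); last by rewrite addbF.
by rewrite addbAC addbT signrN.
Qed.

Lemma sum_flip (h : {ffun I -> bool} -> R) i : \sum_x h (flip i x) = \sum_x h x.
Proof. by rewrite [RHS](reindex_inj (inv_inj (flipK i))). Qed.

Lemma sum_bias_sqr e G :
  \sum_x (\sum_(i in G) bias e x i) ^+ 2 = #|G|%:R * #|{ffun I -> bool}|%:R.
Proof.
under eq_bigr => x _ do rewrite expr2 big_distrlr /=.
rewrite exchange_big /= -sum1_card natr_sum mulr_suml; apply: eq_bigr => i Gi.
rewrite exchange_big /= (bigD1 i) //= [X in _ + X]big1 => [|j /andP[_ ji]].
  rewrite addr0 mul1r -sum1_card natr_sum; apply: eq_bigr => x _.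
  by rewrite -expr2 sqrr_sign.
(* A cross term with [j != i] changes sign under [flip i], so its sum over the cube vanishes. *)
set s := LHS; suff: s = - s by move=> ?; lra.
rewrite -sumrN /s -(sum_flip _ i); apply: eq_bigr => x _.
by rewrite !bias_flip eqxx (negPf ji) mulNr.
Qed.

Lemma sum_bias_norm e G :
  \sum_x `|\sum_(i in G) bias e x i|
    <= Num.sqrt #|G|%:R * #|{ffun I -> bool}|%:R.
Proof.
have [->|G0] := eqVneq G finset.set0.
  by rewrite cards0 sqrtr0 mul0r big1 // => x _; rewrite big_set0 normr0.
set q := Num.sqrt _.
have q0 : 0 < q by rewrite sqrtr_gt0 ltr0n card_gt0.
have qq : q ^+ 2 = #|G|%:R by rewrite sqr_sqrtr.
rewrite -(ler_pM2l q0) mulrA -expr2 qq mulr_sumr.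
(* AM-GM: [2 q |s| <= q^2 + s^2] *)
apply: le_trans (_ : _ <= \sum_x (q ^+ 2 + (\sum_(i in G) bias e x i) ^+ 2) / 2) _.
  apply: ler_sum => x _; set s := \sum_(i in G) _.
  by rewrite -(real_normK (num_real s)); have := sqr_ge0 (q - `|s|); lra.
rewrite -mulr_suml big_split /= sum_bias_sqr sumr_const qq.
by rewrite -[_ *+ #|_|]mulr_natr; lra.
Qed.

Lemma card_slab_le e G (d : R) (F : {ffun I -> bool} -> R) :
  0 <= d ->
  (forall i x, i \in G -> x i = e -> F (flip i x) + d <= F x) ->
  #|[pred x | - d < F x <= 0]|%:R * #|G|%:R
    <= 4 * Num.sqrt #|G|%:R * #|{ffun I -> bool}|%:R :> R.
Proof.
move=> d0 Fgrow; set S := [pred x | _].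
(* Adding the indicators of both thresholds treats the two boundaries at once. *)
pose h x : R := (0 < F x)%R%:R + (- d < F x)%R%:R.
have edge i : i \in G -> #|S|%:R <= 2 * \sum_x h x * bias e x i.
  move=> Gi; rewrite -sum1_card natr_sum big_mkcond /=.
  (* Pairing [x] with [flip i x] turns the correlation into a sum of differences of [h] along edges.
     Each term is nonnegative by monotonicity, and at least 1 on [S]: if [x i = e] the edge crosses
     the threshold [- d], otherwise it crosses 0. *)
  suff -> : 2 * \sum_x h x * bias e x i
      = \sum_x (h x - h (flip i x)) * bias e x i.
    apply: ler_sum => x _; rewrite /S inE /h /bias.
    have [xe|xe] := eqVneq (x i) e.
      have := Fgrow _ _ Gi xe; rewrite xe addbb expr0.
      by do 4 case: ltP => ? /=; lra.
    have := Fgrow i (flip i x) Gi; rewrite flipK ffunE eqxx.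
    have -> : x i (+) e = true by move: xe; case: (x i); case: (e).
    have -> : x i (+) true = e by move: xe; case: (x i); case: (e).
    by move=> /(_ erefl); do 4 case: ltP => ? /=; lra.
  under [RHS]eq_bigr => x _ do rewrite mulrBl.
  rewrite sumrB mulr_natl mulr2n; congr (_ + _).
  rewrite -[LHS](sum_flip _ i) -sumrN; apply: eq_bigr => x _.
  by rewrite bias_flip eqxx mulrN.
apply: le_trans (_ : _ <= \sum_(i in G) 2 * \sum_x h x * bias e x i) _.
  by rewrite mulr_natr -sumr_const; exact: ler_sum.
rewrite -mulr_sumr exchange_big /=.
under eq_bigr => x _ do rewrite -mulr_sumr.
have -> : 4 = 2 * 2 :> R by lra.
rewrite -!mulrA ler_pM2l //.
apply: le_trans (ler_wpM2l _ (sum_bias_norm e G)) => //.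
rewrite mulr_sumr; apply: ler_sum => x _.
apply: le_trans (ler_norm _) _; rewrite normrM ler_wpM2r //.
(* Here [h <= 2]; with the 2 from pairing edge endpoints this makes the constant 4. *)
by rewrite /h; do 2 case: ltP => _; rewrite /= ger0_norm; lra.
Qed.

Lemma prob_slab_le e G (d : R) (F : {ffun I -> bool} -> R) :
  (0 < #|G|)%N -> 0 <= d ->
  (forall i x, i \in G -> x i = e -> F (flip i x) + d <= F x) ->
  prob_unif R [pred x | - d < F x <= 0] <= 4 / Num.sqrt #|G|%:R.
Proof.
move=> G0 d0 /(card_slab_le _ _ _ _ d0); set q := Num.sqrt _.
have q0 : 0 < q by rewrite sqrtr_gt0 ltr0n.
have {1}<- : q ^+ 2 = #|G|%:R by rewrite sqr_sqrtr.
rewrite /prob_unif => le_card.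
rewrite ler_pdivrMr; last by rewrite ltr0n card_ffun card_bool expn_gt0.
rewrite mulrAC ler_pdivlMr // -(ler_pM2r q0) -mulrA -expr2.
by apply: le_trans le_card _; rewrite mulrAC.
Qed.

End Cube.

(** * Signed matrix sums and the final bound *)

Lemma signed_sum_flip (R : realType) (n k : nat) (A : 'I_n -> 'M[R]_k)
    (B : 'M[R]_k) (x : {ffun 'I_n -> bool}) (i : 'I_n) :
  (\sum_j sgn_coord R x j *: A j - B)
    - (\sum_j sgn_coord R (flip _ i x) j *: A j - B)
  = (2 * sgn_coord R x i) *: A i.
Proof.
rewrite opprB addrA subrK -sumrB (bigD1 i) //= big1 => [|j ji].
  rewrite addr0 -scalerBl /sgn_coord ffunE eqxx addbT signrN.
  by rewrite opprK mulr_natl mulr2n.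
by rewrite /sgn_coord ffunE (negPf ji) addbF subrr.
Qed.

Lemma signed_sum_sym (R : realType) (n k : nat) (A : 'I_n -> 'M[R]_k)
    (B : 'M[R]_k) (c : 'I_n -> R) :
  (forall i, A i \is symmetricmx) -> B \is symmetricmx ->
  \sum_j c j *: A j - B \is symmetricmx.
Proof.
move=> sA sB; apply: tr_symmetricmx.
rewrite linearB /= linear_sum /= symmetricmx_tr //; congr (_ - _).
by apply: eq_bigr => i _; rewrite linearZ /= symmetricmx_tr.
Qed.

Lemma loewner_scale2 (R : realType) (k : nat) (X : 'M[R]_k) (c : R) :
  loewner_le c%:M X -> loewner_le (2 * c)%:M (2 *: X).
Proof.
rewrite /loewner_le -scale_scalar_mx -scalerBr => -[sX pX]; split.
  by apply: tr_symmetricmx; rewrite linearZ /= symmetricmx_tr.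
by move=> v; rewrite -scalemxAr -scalemxAl mxE mulr_ge0.
Qed.

(* The index j in {1,2} is j : 'I_2, with 1 and 2 encoded by ord0 and ord_max. *)
Theorem theorem5p9 (R : realType) :
  exists C : R,
  forall (n k : nat) (lambda alpha : R)
         (B : 'I_2 -> 'M[R]_k) (A : 'I_n -> 'I_2 -> 'M[R]_k),
    (0 < n)%N -> (0 < k)%N ->
    0 < lambda -> 0 < alpha <= 1 ->
    (forall j : 'I_2, B j \is symmetricmx) ->
    (forall (i : 'I_n) (j : 'I_2), A i j \is symmetricmx) ->
    (forall i : 'I_n, loewner_le 0 (A i ord0)) ->
    (forall i : 'I_n, loewner_le (A i ord_max) 0) ->
    alpha * n%:R <=
      #|[set i : 'I_n | `[< loewner_le lambda%:M (A i ord0) /\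
                            loewner_le (A i ord_max) (- lambda%:M) >]]%SET|%:R ->
    prob_unif R
      (fun x : {ffun 'I_n -> bool} =>
         [exists j : 'I_2,
            lambda_max (\sum_(i < n) sgn_coord R x i *: A i j - B j)
              \in `]- (2 * lambda), 0] ])
      <= C / (alpha * Num.sqrt n%:R).
Proof.
(* The constant is 4 for each of the two values of [j]. *)
exists 8 => n k lambda alpha B A n0 k0 l0 /andP[a0 a1] sB sA _ _.
set G := [set i | _]%SET => leG.
pose F j x := lambda_max (\sum_(i < n) sgn_coord R x i *: A i j - B j).
have n0R : 0 < n%:R :> R by rewrite ltr0n.
have G0 : (0 < #|G|)%N by rewrite -(ltr0n R) (lt_le_trans _ leG) // mulr_gt0.
have d0 : 0 <= 2 * lambda by rewrite mulr_ge0 // ltW.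
have P1 : prob_unif R [pred x | - (2 * lambda) < F ord0 x <= 0]
    <= 4 / Num.sqrt #|G|%:R.
  (* Good matrices are positive here, so the favourable sign is [+1], encoded by [false]. *)
  apply: (prob_slab_le _ _ false) => // i x; rewrite inE => /asboolP[+ _] xi.
  move=> /loewner_scale2 leA; apply: lambda_max_shift => //.
  - exact: signed_sum_sym.
  - exact: signed_sum_sym.
  - by rewrite signed_sum_flip /sgn_coord xi expr0 mulr1.
have P2 : prob_unif R [pred x | - (2 * lambda) < F ord_max x <= 0]
    <= 4 / Num.sqrt #|G|%:R.
  (* Good matrices are negative here, so the favourable sign is [-1], encoded by [true]. *)
  apply: (prob_slab_le _ _ true) => // i x; rewrite inE => /asboolP[_ leA] xi.
  have {}leA : loewner_le lambda%:M (- A i ord_max).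
    by move: leA; rewrite /loewner_le addrC.
  apply: lambda_max_shift => //.
  - exact: signed_sum_sym.
  - exact: signed_sum_sym.
  - rewrite signed_sum_flip /sgn_coord xi expr1 mulrN1 scaleNr -scalerN.
    exact: loewner_scale2.
apply: le_trans (_ : _ <= 8 / Num.sqrt #|G|%:R) _.
  apply: le_trans (_ : _ <= prob_unif R [pred x | - (2 * lambda) < F ord0 x <= 0]
    + prob_unif R [pred x | - (2 * lambda) < F ord_max x <= 0]) _; last by lra.
  rewrite /prob_unif -mulrDl ler_wpM2r ?invr_ge0 // -natrD ler_nat.
  (* Union bound: the two cardinals add up to union plus intersection, and the latter is dropped. *)
  rewrite -cardUI; apply: leq_trans (leq_addr _ _).
  apply/subset_leq_card/fintype.subsetP => x; rewrite !inE => /existsP[j].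
  rewrite in_itv /= -/(F j x) => hj; apply/orP.
  have [j0|j1] : j = ord0 \/ j = ord_max.
    by case: j {hj} => [[|[|//]] ?]; [left|right]; exact: val_inj.
  - by left; rewrite -j0.
  - by right; rewrite -j1.
(* Since [alpha <= 1], [alpha] is at most its square root, so the left side is at most
   [Num.sqrt (alpha * n%:R)]. *)
have leq0 : alpha * Num.sqrt n%:R <= Num.sqrt #|G|%:R.
  apply: le_trans (_ : _ <= Num.sqrt (alpha * n%:R)) (ler_wsqrtr leG).
  rewrite (sqrtrM _ (ltW a0)) ler_wpM2r ?sqrtr_ge0 //.
  rewrite -{1}(ger0_norm (ltW a0)) -sqrtr_sqr ler_wsqrtr // expr2.
  by rewrite ler_piMl //; exact: ltW.
rewrite ler_pM2l // lef_pV2 // posrE ?sqrtr_gt0 ?ltr0n //.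
by rewrite mulr_gt0 // sqrtr_gt0.
Qed.
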